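(* Let $D$ be a database and let $Q$ queries be received. Let $\Omega_1,\ldots,\Omega_K$ be partitions of $D$ into pairwise disjoint sub-databases (of sizes $|\Omega_k|$). Suppose a proportion $p\in[0,1)$ of the $Q$ queries (namely $pQ$ of them) do not lie in any of the sigma-algebras generated by $\Omega_1,\ldots,\Omega_K$, while each of the remaining $(1-p)Q$ queries is a subset of some $\Omega_k$. Fix $\varepsilon>0$. The benchmark algorithm answers every query $A$ independently by $N(A)+\zeta_A$, $\zeta_A\sim\mathrm{Lap}(1/\varepsilon)$, with total privacy budget $Q\varepsilon$. The online sigma-counting algorithm answers each of the $pQ$ queries not in any sigma-algebra by $N(A)+\zeta_A$, $\zeta_A\sim\mathrm{Lap}(1/\varepsilon)$, and answers each query $A\subseteq\Omega_k$ by $\hat N(A)=\sum_{\omega\in A}\hat N(\omega)$, where independently for each $k$ and $\omega\in\Omega_k$, $\hat N(\omega)=\max(N(\omega)+\zeta_\omega,0)$, $\zeta_\omega\sim\mathrm{Lap}(1/\varepsilon')$, with $\varepsilon'=(1-p)Q\varepsilon/\sum_{k=1}^K|\Omega_k|$, so that its total privacy budget $\sum_k|\Omega_k|\varepsilon'+pQ\varepsilon$ equals $Q\varepsilon$. If $$Q>\frac{\bigl(\sum_{k=1}^K|\Omega_k|\bigr)\sqrt{\max_{1\le k\le K}|\Omega_k|}}{1-p},$$ then the online sigma-counting algorithm has strictly larger utility on the $Q$ queries than the benchmark algorithm.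
   Context: $N(A)$ denotes the true number of rows in the sub-database corresponding to $A$. $\mathrm{Lap}(\lambda)$ is the Laplace distribution with density $(2\lambda)^{-1}e^{-|x|/\lambda}$. The privacy budget is the total differential-privacy parameter by sequential composition (each $\mathrm{Lap}(1/\varepsilon)$ count mechanism contributes $\varepsilon$). The utility of an algorithm on a finite query set $\mathcal F$ is $\mathcal U=\frac{1}{\mathrm{card}(\mathcal F)}\sum_{A\in\mathcal F}\frac{2}{\mathrm{Var}(\hat N(A)\mid N(A))}$. *)

(* Defs.v *)
From HB Require Import structures.
From mathcomp Require Import all_boot all_order all_algebra.
From mathcomp Require Import all_classical all_reals all_analysis.
Set Implicit Arguments. Unset Strict Implicit. Unset Printing Implicit Defensive.
Import Order.TTheory GRing.Theory Num.Theory.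
Local Open Scope classical_set_scope.
Local Open Scope ring_scope.

Definition laplace_law {R : realType} {d} {T : measurableType d}
  (P : probability T R) (X : {RV P >-> R}) (b : R) : Prop :=
  forall B : set R, measurable B ->
    P (X @^-1` B) =
    (\int[@lebesgue_measure R]_(x in B) ((2 * b)^-1 * expR (- `|x| / b))%:E)%E.

Definition mutually_independent {R : realType} {d} {T : measurableType d}
  (P : probability T R) {I : finType} (J : {set I}) (X : I -> {RV P >-> R}) : Prop :=
  forall B : I -> set R, (forall i, measurable (B i)) ->
    P (\big[setI/setT]_(i in J) (X i @^-1` B i)) =
    (\prod_(i in J) P (X i @^-1` B i))%E.

Definition utility {R : realType} {d} {T : measurableType d}
  (P : probability T R) (Qn : nat) (Ans : 'I_Qn -> T -> R) : R :=
  Qn%:R^-1 * \sum_(i < Qn) 2 / fine ('V_P[Ans i]).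

(* A database over the finite record universe D is a histogram N : D -> nat;
   the true count of a sub-database (subset) A is N(A) = sum_{x in A} N x. *)
Definition count {D : finType} (N : D -> nat) (A : {set D}) : nat :=
  \sum_(x in A) N x.

Definition in_sigma {D : finType} (Om : {set {set D}}) (A : {set D}) : Prop :=
  (<<s [set [set x | x \in w] | w in [set w | w \in Om]] >>) [set x | x \in A].

Definition bench_answer {R : realType} {d} {T : measurableType d}
  (P : probability T R) {D : finType} (N : D -> nat) (Qn : nat)
  (A : 'I_Qn -> {set D}) (xi : 'I_Qn -> {RV P >-> R}) (i : 'I_Qn) : T -> R :=
  fun t => (count N (A i))%:R + xi i t.

(* Online sigma-counting algorithm.  The noise family Z is indexed by
   inl i (query noise zeta_{A_i}, used when A_i is in no sigma-algebra) and
   inr (k, w) (noise zeta_w for the block w of Om k).  kq i = None means query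
   i is in no sigma-algebra; kq i = Some k means A_i is answered through Om k:
   hat N(A_i) = sum_{w in Om k, w subset A_i} max(N(w) + zeta_w, 0). *)
Definition sigma_answer {R : realType} {d} {T : measurableType d}
  (P : probability T R) {D : finType} (N : D -> nat) (K : nat)
  (Om : 'I_K -> {set {set D}}) (Qn : nat) (A : 'I_Qn -> {set D})
  (kq : 'I_Qn -> option 'I_K)
  (Z : 'I_Qn + ('I_K * {set D}) -> {RV P >-> R}) (i : 'I_Qn) : T -> R :=
  fun t => match kq i with
  | None => (count N (A i))%:R + Z (inl i) t
  | Some k => \sum_(w in Om k | w \subset A i)
                Num.max ((count N w)%:R + Z (inr (k, w)) t) 0
  end.

Definition sigma_noise_index {D : finType} (K : nat)
  (Om : 'I_K -> {set {set D}}) (Qn : nat) (kq : 'I_Qn -> option 'I_K) :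
  {set 'I_Qn + ('I_K * {set D})} :=
  [set x | match x with
           | inl i => kq i == None
           | inr kw => kw.2 \in Om kw.1
           end].

Arguments laplace_law {R d T} P X b.
Arguments mutually_independent {R d T} P {I} J X.
Arguments utility {R d T} P Qn Ans.
Arguments count {D} N A.
Arguments in_sigma {D} Om A.
Arguments bench_answer {R d T} P {D} N {Qn} A xi i _.
Arguments sigma_answer {R d T} P {D} N {K} Om {Qn} A kq Z i _.
Arguments sigma_noise_index {D K} Om {Qn} kq.

(* Main.v *)
(* Every benchmark answer has variance 2/eps^2. A query A answered through Om k
   is a union of blocks of Om k, so its answer is a sum of at most M independent
   clamped counts max(N(w) + zeta_w, 0). Clamping at 0 is 1-Lipschitz and fixes
   N(w) >= 0, so each clamped count stays within |zeta_w| of N(w), hence has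
   variance at most E[zeta_w^2] = 2/eps'^2; the sum has variance at most
   2M/eps'^2, which is < 2/eps^2 because the condition on Q says
   eps' > sqrt M * eps. Since 2/0 = 0 here, the variance must also be shown to be
   positive: A is nonempty, so it contains a block, and the sum exceeds any
   constant with positive probability. *)
Require Import Defs.
From HB Require Import structures.
From mathcomp Require Import all_boot all_order all_algebra.
From mathcomp Require Import all_classical all_reals all_analysis.
From mathcomp Require Import measurable_realfun.
From mathcomp Require Import ring lra.
Import Order.TTheory GRing.Theory Num.Theory.
Local Open Scope classical_set_scope.
Local Open Scope ring_scope.
Import numFieldNormedType.Exports HBNNSimple.

(** * Integration against a measure with a density *)

(** For indicators this is the hypothesis on [nu]; linearity gives simple functions, and monotone
    convergence along [nnsfun_approx] gives every nonnegative measurable [g]. *)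
Lemma ge0_integral_density (R : realType) d (T : measurableType d)
    (mu nu : {measure set T -> \bar R}) (f : T -> R) (g : T -> \bar R) :
  measurable_fun setT f -> (forall x, 0 <= f x) ->
  (forall B, measurable B -> nu B = \int[mu]_(x in B) (f x)%:E)%E ->
  measurable_fun setT g -> (forall x, 0 <= g x)%E ->
  (\int[nu]_x g x = \int[mu]_x (g x * (f x)%:E))%E.
Proof.
move=> mf f0 nuE mg g0.
have mEf : measurable_fun setT (EFin \o f) by exact/measurable_EFinP.
pose g_ := nnsfun_approx measurableT mg.
have cg x : ((g_ n x)%:E @[n --> \oo] --> g x)%E.
  by apply: cvg_nnsfun_approx.
transitivity (limn (fun n => \int[nu]_x (g_ n x)%:E))%E.
  rewrite -monotone_convergence//.
  - by apply: eq_integral => x _; apply/esym/cvg_lim.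
  - by move=> n; exact/measurable_EFinP.
  - by move=> n x _; rewrite lee_fin.
  - by move=> x _ m n mn; rewrite lee_fin; exact/lefP/nd_nnsfun_approx.
transitivity (limn (fun n => \int[mu]_x ((g_ n x)%:E * (f x)%:E)))%E; last first.
  rewrite -monotone_convergence//.
  - apply: eq_integral => x _; apply/cvg_lim => //.
    by apply: cvgeZr => //; exact: cg.
  - by move=> n; apply: emeasurable_funM => //; exact/measurable_EFinP.
  - by move=> n x _; rewrite mule_ge0// lee_fin.
  - move=> x _ m n mn; rewrite lee_wpmul2r ?lee_fin//.
    exact/lefP/nd_nnsfun_approx.
congr (limn _); apply/funext => n.
(* The contribution of a single level set of the simple function [g_ n]. *)
have ind k : (\int[nu]_x (k * \1_(g_ n @^-1` [set k]) x)%:E =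
    \int[mu]_x ((k * \1_(g_ n @^-1` [set k]) x)%:E * (f x)%:E))%E.
  rewrite integralZl_indic_nnsfun// integral_indic// setIT nuE//.
  (* A negative [k] is not a value of [g_ n], so its level set is empty and both sides vanish. *)
  have [k0|k0] := leP 0 k; last first.
    rewrite preimage_nnfun0// integral_set0 mule0 integral0_eq// => x _.
    by rewrite indic0 /= mulr0 mul0e.
  under [RHS]eq_integral do rewrite EFinM -muleA.
  rewrite ge0_integralZl//; last 2 first.
  - by apply: emeasurable_funM => //; exact/measurable_EFinP/measurable_indic.
  - by move=> x _; rewrite mule_ge0// lee_fin.
  congr (_ * _)%E; rewrite [LHS]integral_mkcond; apply: eq_integral => x _.
  by rewrite patchE indicE; case: ifPn => _; rewrite ?mul1e ?mul0e.
have ge0 r x : (0 <= (r * \1_(g_ n @^-1` [set r]) x)%:E)%E.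
  by rewrite EFinM nnfun_muleindic_ge0.
under eq_integral do rewrite fimfunE -fsumEFin//.
rewrite ge0_integral_fsum//; last first.
  by move=> r; exact/measurable_EFinP/measurable_funM.
under eq_fsbigr do rewrite ind.
rewrite -ge0_integral_fsum//.
- apply: eq_integral => x _; rewrite [in RHS]fimfunE -fsumEFin//.
  by rewrite ge0_mule_fsuml// => r; exact: ge0.
- move=> r; apply: emeasurable_funM => //.
  by exact/measurable_EFinP/measurable_funM.
- by move=> r x _; apply: mule_ge0; [exact: ge0|rewrite lee_fin].
Qed.

(** * The Laplace density and its second moment *)

Section laplace_density.
Context {R : realType} {b : R}.
Hypothesis b0 : 0 < b.

Let mu := @lebesgue_measure R.

Lemma continuous_laplace_pdf :
  continuous (fun x : R => (2 * b)^-1 * expR (- `|x| / b)).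
Proof.
move=> x; apply: cvgM; first exact: cvg_cst.
apply: (@continuous_comp _ _ _ (fun x : R => - `|x| / b) expR); last first.
  exact: continuous_expR.
by apply: cvgM; [apply: cvgN; exact: norm_continuous|exact: cvg_cst].
Qed.

Lemma laplace_pdf_gt0 (x : R) : 0 < (2 * b)^-1 * expR (- `|x| / b).
Proof. by rewrite mulr_gt0 ?expR_gt0// invr_gt0 mulr_gt0. Qed.

(** Antiderivative, from two integrations by parts, of [x ^+ 2] times the density on the positive
    half-line. It runs from [- b ^+ 2] at 0 to 0 at infinity. *)
Let F (x : R) := - ((x ^+ 2 / 2 + b * x + b ^+ 2) * expR (- x / b)).

Let is_derive_F (x : R) :
  is_derive x 1 F (x ^+ 2 * ((2 * b)^-1 * expR (- x / b))).
Proof.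
rewrite /F.
apply: is_derive_eq.
rewrite /GRing.scale/=.
set e := expR _.
by field; rewrite gt_eqF.
Qed.

Let cvg_F : F x @[x --> +oo] --> 0.
Proof.
rewrite -oppr0; apply: cvgN.
(* With [v = x / (2 * b)], the exponential in [F] is [expR (- v)] squared: one factor absorbs the
   quadratic polynomial, the other forces the limit 0. *)
have lim : 8 * b ^+ 2 * expR (- ((2 * b)^-1 * x)) @[x --> +oo] --> 0.
  rewrite -[X in _ --> X](mulr0 (8 * b ^+ 2)); apply: cvgMr.
  apply: (@cvg_comp _ _ _ (fun x : R => (2 * b)^-1 * x) (fun z : R => expR (- z))
    _ (pinfty_nbhs R)); last exact: cvgr_expR.
  by apply: gt0_cvgMry; [rewrite invr_gt0 mulr_gt0|exact: cvg_id].
apply: (squeeze_cvgr _ (cvg_cst 0) lim).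
near=> x.
have x0 : 0 <= x by near: x; exact: nbhs_pinfty_ge.
have bn0 : b != 0 by rewrite gt_eqF.
apply/andP; split.
  by rewrite mulr_ge0 ?expR_ge0// !addr_ge0 ?mulr_ge0 ?sqr_ge0// ltW.
set v := (2 * b)^-1 * x.
have v0 : 0 <= v by rewrite mulr_ge0// invr_ge0 mulr_ge0// ltW.
have -> : x = 2 * b * v by rewrite /v; field.
have -> : - (2 * b * v) / b = - v + - v by field.
rewrite expRD mulrA ler_wpM2r ?expR_ge0//.
have := expR_ge1Dxn 1 v0; rewrite (_ : 2`! = 2)%N// => ev.
rewrite expRN ler_pdivrMr ?expR_gt0//.
have b2 : 0 <= b ^+ 2 by exact: sqr_ge0.
have : 8 * b ^+ 2 * (1 + v ^+ 2 / 2) <= 8 * b ^+ 2 * expR v.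
  by rewrite ler_wpM2l// mulr_ge0.
apply: le_trans.
(* In terms of [v] the polynomial is [b ^+ 2 * (2 * v ^+ 2 + 2 * v + 1)]. This is its gap to
   [8 * b ^+ 2 * (1 + v ^+ 2 / 2)], with the square completed. *)
have : 0 <= b ^+ 2 * (2 * (v - 1 / 2) ^+ 2 + 13 / 2).
  by rewrite mulr_ge0// addr_ge0// mulr_ge0// sqr_ge0.
by nra.
Unshelve. all: by end_near. Qed.

Lemma integral_sqr_laplace_pdf :
  (\int[mu]_x ((x ^+ 2)%:E * ((2 * b)^-1 * expR (- `|x| / b))%:E) =
   (2 * b ^+ 2)%:E)%E.
Proof.
under eq_integral do rewrite -EFinM.
(* The integrand is even, so the integral is twice the one over the half-line, where [F] applies. *)
rewrite ge0_symfun_integralT; last 3 first.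
- by move=> x; rewrite mulr_ge0 ?sqr_ge0// ltW// laplace_pdf_gt0.
- move=> x; apply: cvgM; last exact: continuous_laplace_pdf.
  exact: exprn_continuous.
- by move=> x; rewrite /= sqrrN normrN.
rewrite (_ : [set x | 0 <= x] = `[0, +oo[%classic); last by rewrite set_itvcy.
under eq_integral.
  move=> x; rewrite inE/= in_itv/= andbT => x0.
  rewrite ger0_norm//; over.
have dF x : derivable F x 1 by have [] := is_derive_F x.
have F0 : F 0 = - b ^+ 2.
  by rewrite /F oppr0 expr0n/= !mul0r mulr0 expR0 !add0r mulr1.
rewrite (@ge0_continuous_FTC2y _ _ F _ 0)//.
- by rewrite F0 -EFinB -EFinM sub0r opprK.
- move=> x x0; rewrite mulr_ge0 ?sqr_ge0// mulr_ge0 ?expR_ge0//.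
  by rewrite invr_ge0 mulr_ge0// ltW.
- apply: continuous_subspaceT => x.
  apply: cvgM; first exact: exprn_continuous.
  apply: cvgM; first exact: cvg_cst.
  apply: (@continuous_comp _ _ _ (fun x : R => - x / b) expR); last first.
    exact: continuous_expR.
  by apply: cvgM; [apply: cvgN; exact: cvg_id|exact: cvg_cst].
- apply: cvg_at_right_filter.
  by have /derivable1_diffP/differentiable_continuous := dF 0.
- by move=> x _; rewrite derive1E; have [_ ->] := is_derive_F x.
Qed.

End laplace_density.

(** * Square integrability and moments under a Laplace law *)

Lemma Lfun2_sqr_lty (R : realType) d (T : measurableType d)
    (P : probability T R) (X : T -> R) : measurable_fun setT X ->
  ('E_P[X ^+ 2] < +oo)%E -> X \in Lfun P 2%:E.
Proof.
move=> mX X2; rewrite inE; apply/andP; split; rewrite inE//=.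
rewrite /finite_norm unlock /= poweR_lty//.
move: X2; rewrite unlock; apply: le_lt_trans; rewrite le_eqVlt; apply/orP; left.
apply/eqP; apply: eq_integral => x _ /=.
by rewrite powR_mulrn ?normr_ge0// real_normK ?num_real.
Qed.

Section laplace_law_moments.
Context {R : realType} {d} {T : measurableType d} {P : probability T R}.
Context {X : {RV P >-> R}} {b : R}.
Hypothesis b0 : 0 < b.
Hypothesis lapX : laplace_law P X b.

Let mpdf : measurable_fun setT (fun x : R => (2 * b)^-1 * expR (- `|x| / b)).
Proof. by apply: continuous_measurable_fun; exact: continuous_laplace_pdf. Qed.

Lemma laplace_law_second_moment : ('E_P[(X : T -> R) ^+ 2] = (2 * b ^+ 2)%:E)%E.
Proof.
rewrite -integral_sqr_laplace_pdf// unlock.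
(* [lebesgue_measure] lives on [measurableTypeR R], whose display is not that of
   [R]: X is repackaged as a random variable with values there. *)
have mX : @measurable_fun _ _ T (measurableTypeR R) setT X.
  by have := measurable_funPT X.
pose mX' := isMeasurableFun.Build _ _ T (measurableTypeR R) X mX.
pose X' : {mfun T >-> measurableTypeR R} := HB.pack (X : T -> measurableTypeR R) mX'.
rewrite -(@ge0_integral_density R _ (measurableTypeR R) (@lebesgue_measure R)
  (distribution P X') _ (fun x => (x ^+ 2)%:E))//.
- rewrite ge0_integral_distribution//.
    by apply/measurable_EFinP; exact: exprn_measurable.
  by move=> y; rewrite lee_fin sqr_ge0.
- by move=> x; rewrite ltW// laplace_pdf_gt0.
- by apply/measurable_EFinP; exact: exprn_measurable.
- by move=> x; rewrite lee_fin sqr_ge0.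
Qed.

Lemma laplace_law_Lfun2 : (X : T -> R) \in Lfun P 2%:E.
Proof.
by apply: Lfun2_sqr_lty => //; rewrite laplace_law_second_moment ltry.
Qed.

(** The density is even and Lebesgue measure is invariant under reflection. This symmetry yields the
    mean. *)
Lemma laplace_law_opp : laplace_law P (- X : {RV P >-> R}) b.
Proof.
move=> B mB.
have mNB : measurable (-%R @^-1` B : set R).
  by rewrite -[_ @^-1` _]setTI; exact: (@oppr_measurable R setT).
rewrite [LHS](_ : _ = P (X @^-1` (-%R @^-1` B)))// lapX//.
pose f (x : R) := ((2 * b)^-1 * expR (- `|x| / b))%:E.
transitivity (\int[lebesgue_measure]_(x in (-%R : _ -> measurableTypeR R) @^-1` B)
    f (- x)%R)%E.
  by apply: eq_integral => x _; rewrite /f normrN.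
rewrite -[LHS](@ge0_integral_pushforward _ _ (measurableTypeR R)
  (measurableTypeR R) R (-%R : _ -> measurableTypeR R) _ _ B f)//=.
- by apply: eq_measure_integral => A mA _; exact: lebesgue_measureN.
- by apply/measurable_EFinP/measurable_funTS.
- by move=> x _; rewrite lee_fin ltW// laplace_pdf_gt0.
Qed.

(** [X] and [- X] have the same law, so the mean equals its opposite; it is finite because [X] is
    square integrable. *)
Lemma laplace_law_mean : ('E_P[X] = 0)%E.
Proof.
have X1 : (X : T -> R) \in Lfun P 1.
  by apply: Lfun_subset12; [exact: fin_num_measure|exact: laplace_law_Lfun2].
have iX : P.-integrable setT (EFin \o X) by exact/Lfun1_integrable.
have iNX : P.-integrable setT (EFin \o (- X : {RV P >-> R})).
  by apply/Lfun1_integrable; rewrite rpredN.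
have EN : ('E_P[- (X : T -> R)] = 'E_P[X])%E.
  rewrite unlock.
  rewrite -(integral_distribution (X := X) (f := EFin))//.
  rewrite -(integral_distribution (X := (- X : {RV P >-> R})) (f := EFin))//.
  apply: eq_measure_integral => A mA _.
  exact: etrans (laplace_law_opp _ mA) (esym (lapX _ mA)).
have := EN; have -> : - (X : T -> R) = (-1) \o* X.
  by apply/funext => t /=; rewrite mulrN1.
rewrite expectationZl//.
move: (expectation_fin_num X1); case: ('E_P[X])%E => //= r _.
by rewrite -EFinM mulN1r => -[r0]; congr (_%:E); lra.
Qed.

Lemma laplace_law_variance : ('V_P[X] = (2 * b ^+ 2)%:E)%E.
Proof.
rewrite varianceE ?laplace_law_Lfun2// laplace_law_mean.
by rewrite laplace_law_second_moment expe2 mule0 sube0.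
Qed.

(** On this interval [|x|] is at most [|a| + 1], so the density is bounded below by the positive
    constant [m]. The lemma serves to show that sums of clamped counts are not almost surely
    constant. *)
Lemma laplace_law_itv_gt0 (a : R) : (0 < P (X @^-1` `[a, (a + 1)%R]))%E.
Proof.
rewrite lapX//.
set m : R := (2 * b)^-1 * expR (- (`|a| + 1) / b).
have m0 : 0 < m by rewrite mulr_gt0 ?expR_gt0// invr_gt0 mulr_gt0.
apply: (@lt_le_trans _ _ (\int[lebesgue_measure]_(x in `[a, (a + 1)%R]) m%:E))%E.
  rewrite integral_cst//= lebesgue_measure_itv/= lte_fin ltrDl ltr01.
  by rewrite -EFinB addrAC subrr add0r mule1 lte_fin.
apply: ge0_le_integral => //=.
- by move=> x _; rewrite lee_fin ltW.
- by apply/measurable_EFinP/measurable_funTS.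
- move=> x; rewrite in_itv/= => /andP[ax xa1].
  rewrite lee_fin ler_wpM2l ?invr_ge0 ?mulr_ge0// ?(ltW b0)// ler_expR.
  rewrite ler_wpM2r ?invr_ge0 ?(ltW b0)// lerN2.
  have -> : x = a + (x - a) by lra.
  apply: (le_trans (ler_normD _ _)); rewrite lerD2l ger0_norm; lra.
Qed.

End laplace_law_moments.

(** * Pairwise independence and vanishing covariance *)

Lemma mutually_independent_pair {R : realType} {d} {T : measurableType d}
    {P : probability T R} {I : finType} {J : {set I}} {X : I -> {RV P >-> R}}
    {i j : I} {A B : set R} :
  mutually_independent P J X -> i \in J -> j \in J -> i != j ->
  measurable A -> measurable B ->
  (P ((X i @^-1` A) `&` (X j @^-1` B)) = P (X i @^-1` A) * P (X j @^-1` B))%E.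
Proof.
move=> indX iJ jJ ij mA mB.
(* Taking the whole line at every other index turns the product formula for the family into the one
   for a pair. *)
pose C k : set R := if k == i then A else if k == j then B else setT.
have Ci : C i = A by rewrite /C eqxx.
have Cj : C j = B by rewrite /C eq_sym (negbTE ij) eqxx.
have CT k : (k \in J) && (k != i) && (k != j) -> C k = setT.
  by move=> /andP[/andP[_ /negbTE ki] /negbTE kj]; rewrite /C ki kj.
have mC k : measurable (C k) by rewrite /C; do 2 case: ifP => // _.
have jJi : (j \in J) && (j != i) by rewrite jJ eq_sym.
have := indX C mC.
rewrite (bigD1 i iJ) (bigD1 j jJi) /= big1; last first.
  by move=> k /CT ->; rewrite preimage_setT.
rewrite (bigD1 i iJ) (bigD1 j jJi) /= big1; last first.
  by move=> k /CT ->; rewrite preimage_setT probability_setT.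
by rewrite setIT mule1 Ci Cj.
Qed.

Section independence.
Context {R : realType} {d} {T : measurableType d} {P : probability T R}.
Context (U V : {RV P >-> R}).
Hypothesis indUV : forall A B, measurable A -> measurable B ->
  (P ((U @^-1` A) `&` (V @^-1` B)) = P (U @^-1` A) * P (V @^-1` B))%E.
Hypotheses (U0 : forall t, 0 <= U t) (V0 : forall t, 0 <= V t).

(** The law of the pair is the product of the two laws, because they agree on rectangles; Tonelli
    then separates the integrals. *)
Lemma ge0_expectationM_indep : ('E_P[(U : T -> R) * V] = 'E_P[U] * 'E_P[V])%E.
Proof.
have mW : measurable_fun setT (fun t => (U t, V t)).
  by apply: measurable_fun_pair.
pose mW' := isMeasurableFun.Build _ _ T (R * R)%type (fun t => (U t, V t)) mW.
pose W : {mfun T >-> (R * R)%type} := HB.pack (fun t => (U t, V t)) mW'.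
have mnorm : measurable_fun setT (fun x : R => `|x|).
  exact: normr_measurable.
have mf : measurable_fun setT (fun z : R * R => (`|z.1| * `|z.2|)%:E).
  apply/measurable_EFinP/measurable_funM.
  - exact: (measurableT_comp mnorm measurable_fst).
  - exact: (measurableT_comp mnorm measurable_snd).
have mn : measurable_fun setT (fun x : R => `|x|%:E).
  exact/measurable_EFinP.
rewrite unlock.
(* Absolute values make the integrand nonnegative on the whole plane, as Tonelli requires, and
   change nothing at the nonnegative values of [U] and [V]. *)
transitivity (\int[distribution P W]_z (`|z.1| * `|z.2|)%:E)%E.
  rewrite ge0_integral_distribution//.
  by apply: eq_integral => t _ /=; rewrite !ger0_norm.
transitivity (\int[(distribution P U \x distribution P V)%E]_z
    (`|z.1| * `|z.2|)%:E)%E.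
  apply: eq_measure_integral => A mA _.
  apply/esym; exact: product_measure_unique.
rewrite fubini_tonelli1//=.
rewrite /fubini_F/=.
have EV : (\int[P]_t (V t)%:E = \int[distribution P V]_y `|y|%:E)%E.
  rewrite ge0_integral_distribution//.
  by apply: eq_integral => t _ /=; rewrite ger0_norm.
have EU : (\int[P]_t (U t)%:E = \int[distribution P U]_y `|y|%:E)%E.
  rewrite ge0_integral_distribution//.
  by apply: eq_integral => t _ /=; rewrite ger0_norm.
rewrite EU EV -ge0_integralZr//; last by apply: integral_ge0.
apply: eq_integral => x _; rewrite -ge0_integralZl//.
Qed.

Lemma covariance_indep : (U : T -> R) \in Lfun P 2%:E ->
  (V : T -> R) \in Lfun P 2%:E -> covariance P U V = 0%E.
Proof.
move=> U2 V2.
have P1 := Lfun_subset12 (fin_num_measure P _ measurableT).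
have U1 := P1 _ U2; have V1 := P1 _ V2.
rewrite covarianceE ?Lfun2_mul_Lfun1// ge0_expectationM_indep subee//.
by rewrite fin_numM// expectation_fin_num.
Qed.

End independence.

(** * Variance of a sum of uncorrelated variables *)

Section variance_sum.
Context {R : realType} {d} {T : measurableType d} {P : probability T R}.
Context (I : eqType) (X : I -> T -> R).

Lemma variance_sum (r : seq I) : uniq r ->
  (forall i, i \in r -> X i \in Lfun P 2%:E) ->
  (forall i j, i \in r -> j \in r -> i != j -> covariance P (X i) (X j) = 0%E) ->
  ('V_P[(\sum_(i <- r) X i)%R] = \sum_(i <- r) 'V_P[X i])%E.
Proof.
elim: r => [|i r IHr] /=; first by rewrite !big_nil variance_cst.
move=> /andP[ir ur] X2 cov0.
have X2r j : j \in r -> X j \in Lfun P 2%:E by move=> jr; rewrite X2// inE jr orbT.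
have Xi2 : X i \in Lfun P 2%:E by rewrite X2// mem_head.
have S2 s : {subset s <= r} -> (\sum_(j <- s) X j)%R \in Lfun P 2%:E.
  move=> sr; rewrite big_seq; apply: rpred_sum; first by rewrite lee1n.
  by move=> p2 j js; apply: X2r; exact: sr.
rewrite !big_cons.
rewrite (_ : X i + \sum_(j <- r) X j = X i \+ (\sum_(j <- r) X j))//.
rewrite varianceD//; last exact: S2.
rewrite IHr//; last by move=> j k jr kr; apply: cov0; rewrite inE ?jr ?kr orbT.
suff -> : covariance P (X i) (\sum_(j <- r) X j)%R = 0%E.
  by rewrite mule0 adde0.
(* The inner induction runs over lists contained in [r], so that the hypotheses about the fixed [r]
   remain usable. *)
have : {subset r <= r} by [].
elim: {-2}r => [|j s IHs] sr.
  by rewrite big_nil covariance_cst_r.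
have jr : j \in r by rewrite sr// mem_head.
have sr' : {subset s <= r} by move=> k ks; rewrite sr// inE ks orbT.
rewrite big_cons (_ : X j + \sum_(k <- s) X k = X j \+ (\sum_(k <- s) X k))//.
rewrite covarianceDr//; [|exact: X2r|exact: S2].
rewrite IHs// adde0 cov0//; first exact: mem_head.
  by rewrite inE jr orbT.
by apply: contraNneq ir => ->.
Qed.

End variance_sum.

(** * Variance of clamped noisy counts *)

Section clamped_noise.
Context {R : realType} {d} {T : measurableType d} {P : probability T R}.

Lemma variance_le_second_moment (X : T -> R) : X \in Lfun P 2%:E ->
  ('V_P[X] <= 'E_P[X ^+ 2])%E.
Proof.
move=> X2; rewrite varianceE//.
have := expectation_fin_num (Lfun_subset12 (fin_num_measure P _ measurableT) X2).
move=> X1; rewrite -(fineK X1) -EFin_expe -[leRHS]sube0.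
by apply: leeB => //; rewrite lee_fin sqr_ge0.
Qed.

Section one_noise.
Context (X : {RV P >-> R}) (c : R).
Hypothesis X2 : (X : T -> R) \in Lfun P 2%:E.
Hypothesis c0 : 0 <= c.

Let Y t := Num.max (c + X t) 0.

Lemma measurable_clamp : measurable_fun setT Y.
Proof.
by apply: measurable_maxr => //; exact: measurable_funD.
Qed.

(** Centring at [c] instead of the mean leaves the variance unchanged and gives a variable dominated
    pointwise by [|X|]. *)
Let W t := Y t - c.

Let mW : measurable_fun setT W.
Proof. by apply: measurable_funB => //; exact: measurable_clamp. Qed.

Let W2X2 : ('E_P[W ^+ 2] <= 'E_P[(X : T -> R) ^+ 2])%E.
Proof.
apply: expectation_le.
- exact: (measurable_funM mW mW).
- by apply: measurable_funM.
- by move=> t; exact: sqr_ge0.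
- by move=> t; exact: sqr_ge0.
apply: aeW => t /=; rewrite !fctE /= -ler_sqrt ?sqr_ge0// !sqrtr_sqr.
(* Where the clamp acts, [W = - c] and [0 <= c <= - X]; elsewhere [W = X]. *)
rewrite /W /Y; case: (leP (c + X t) 0) => cX; last by rewrite addrAC subrr add0r.
have Xc : c <= - X t by rewrite -subr_ge0 -opprD oppr_ge0 addrC.
rewrite sub0r normrN ger0_norm//; apply: (le_trans Xc).
by rewrite -normrN ler_norm.
Qed.

Let W2 : W \in Lfun P 2%:E.
Proof.
apply: Lfun2_sqr_lty => //; apply: le_lt_trans W2X2 _.
have /integrableP[_] := Lfun2_integrable_sqr X2.
rewrite unlock; apply: le_lt_trans; rewrite le_eqVlt; apply/orP; left.
by apply/eqP; apply: eq_integral => t _ /=; rewrite ger0_norm// sqr_ge0.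
Qed.

Let YE : Y = W \+ cst c.
Proof. by apply/funext => t; rewrite /W /= subrK. Qed.

Lemma clamp_Lfun2 : Y \in Lfun P 2%:E.
Proof.
rewrite YE; apply: rpredD; first by rewrite lee1n.
  by move=> p2; exact: W2.
by move=> p2; exact: Lfun_cst.
Qed.

Lemma clamp_variance_le : ('V_P[Y] <= 'E_P[(X : T -> R) ^+ 2])%E.
Proof.
rewrite YE varianceD_cst_r//; apply: le_trans W2X2.
exact: variance_le_second_moment.
Qed.

End one_noise.

(** Chebyshev at distance 1: the variance is at least the probability that [S] lies 1 or more away
    from its mean, hence at least that of [S] exceeding the mean by 1. *)
Lemma variance_gt0_unbounded (S : {RV P >-> R}) :
  (forall a, 0 < P [set t | (a <= S t)%R])%E -> (0 < 'V_P[S])%E.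
Proof.
move=> S0; apply: (lt_le_trans (S0 (fine 'E_P[S] + 1))).
have := chebyshev S ltr01; rewrite expr1n invr1 mul1e; apply: le_trans.
have mS c : measurable [set t | c <= S t].
  rewrite [X in measurable X](_ : _ = S @^-1` `[c, +oo[); last first.
    by apply/seteqP; split => t /=; rewrite in_itv/= andbT.
  exact: measurable_funPTI.
apply: le_measure; rewrite ?inE//.
- have mD : measurable_fun setT (fun t => S t - fine 'E_P[S]).
    by apply: measurable_funB.
  have mg : measurable_fun setT (fun t => `|S t - fine 'E_P[S]|).
    by apply: measurableT_comp mD; exact: normr_measurable.
  rewrite [X in measurable X](_ : _ =
    setT `&` (fun t => `|S t - fine 'E_P[S]|) @^-1` `[1, +oo[); last first.
    by rewrite setTI; apply/seteqP; split => t /=; rewrite in_itv/= andbT.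
  exact: mg.
- by move=> t /= St; rewrite (le_trans _ (ler_norm _))// lerBrDl.
Qed.

(** Independent noises give uncorrelated clamped counts, so the variances add. The variance is
    exhibited as a real [v] so that [fine] can later be evaluated on it. *)
Lemma sum_clamp_variance {I : finType} {B : {set I}} (X : I -> {RV P >-> R})
    (c : I -> R) (b : R) : 0 < b -> B != finset.set0 ->
  (forall w, 0 <= c w) ->
  (forall w, w \in B -> laplace_law P (X w) b) ->
  (forall v w, v \in B -> w \in B -> v != w ->
    forall A1 A2, measurable A1 -> measurable A2 ->
    P ((X v @^-1` A1) `&` (X w @^-1` A2)) =
      P (X v @^-1` A1) * P (X w @^-1` A2))%E ->
  exists2 v : R, ('V_P[fun t => (\sum_(w in B) Num.max (c w + X w t) 0)%R] = v%:E)%E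
    & 0 < v <= #|B|%:R * (2 * b ^+ 2).
Proof.
move=> b0 /set0Pn[w0 w0B] c0 lapX indX.
pose Y w t := Num.max (c w + X w t) 0.
have X2 w : w \in B -> (X w : T -> R) \in Lfun P 2%:E.
  by move=> wB; exact: laplace_law_Lfun2 b0 (lapX w wB).
have Y2 w : w \in B -> Y w \in Lfun P 2%:E.
  by move=> wB; apply: clamp_Lfun2 => //; exact: X2.
pose mY w := isMeasurableFun.Build _ _ T R (Y w) (measurable_clamp (X w) (c w)).
pose RY w : {mfun T >-> R} := HB.pack (Y w) (mY w).
pose SY := \sum_(w <- enum B) Y w.
have SE : (fun t => \sum_(w in B) Y w t) = SY.
  by apply/funext => t; rewrite /SY fct_sumE big_enum.
have covY v w : v \in B -> w \in B -> v != w -> covariance P (Y v) (Y w) = 0%E.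
  move=> vB wB vw; apply: (@covariance_indep _ _ _ P (RY v) (RY w)).
  - move=> A1 A2 mA1 mA2.
    (* An event on a clamped count is an event on its noise, through the preimage under the
       clamp. *)
    have mC e A : measurable A -> measurable ((fun x : R => Num.max (c e + x) 0) @^-1` A).
      move=> mA; rewrite -[_ @^-1` _]setTI.
      have : measurable_fun setT (fun x : R => Num.max (c e + x) 0).
        by apply: measurable_maxr => //; exact: measurable_funD.
      by apply.
    exact: (indX v w vB wB vw _ _ (mC v _ mA1) (mC w _ mA2)).
  - by move=> t; rewrite /= /Y le_max lexx orbT.
  - by move=> t; rewrite /= /Y le_max lexx orbT.
  - exact: Y2.
  - exact: Y2.
have S2 : SY \in Lfun P 2%:E.
  rewrite /SY big_enum; apply: rpred_sum; first by rewrite lee1n.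
  by move=> p2 w wB; exact: Y2.
have VE : ('V_P[SY] = \sum_(w <- enum B) 'V_P[Y w])%E.
  apply: variance_sum; first exact: enum_uniq.
  - by move=> w; rewrite mem_enum => /Y2.
  - by move=> v w; rewrite !mem_enum; exact: covY.
have Vle : ('V_P[SY] <= (#|B|%:R * (2 * b ^+ 2))%:E)%E.
  rewrite VE big_enum /=.
  apply: (@le_trans _ _ (\sum_(w in B) (2 * b ^+ 2)%:E)%E).
    apply: lee_sum => w wB; rewrite -(laplace_law_second_moment b0 (lapX w wB)).
    by apply: clamp_variance_le => //; exact: X2.
  by rewrite sumEFin sumr_const lee_fin -[leLHS]mulr_natl lexx.
have Vgt : (0 < 'V_P[SY])%E.
  have mS : measurable_fun setT SY.
    move: S2; rewrite inE => /andP[]; rewrite inE//.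
  pose mS' := isMeasurableFun.Build _ _ T R _ mS.
  pose S : {mfun T >-> R} := HB.pack SY mS'.
  (* Whenever the noise at [w0] lies in [[a, a + 1]], the sum is at least [a]: [c w0] is nonnegative
     and so are all the other terms. *)
  apply: (@variance_gt0_unbounded S) => a.
  apply: (lt_le_trans (laplace_law_itv_gt0 b0 (lapX w0 w0B) a)).
  apply: le_measure; rewrite ?inE.
  - exact: measurable_funPTI.
  - rewrite [X in measurable X](_ : _ = S @^-1` `[a, +oo[); last first.
      by apply/seteqP; split => t /=; rewrite in_itv/= andbT.
    exact: measurable_funPTI.
  - move=> t /=; rewrite in_itv/= => /andP[aX _].
    apply: (le_trans aX); rewrite -SE (bigD1 w0)//=.
    apply: (@le_trans _ _ (Y w0 t)).
      by rewrite /Y le_max lerDr c0.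
    rewrite lerDl; apply: sumr_ge0 => w _.
    by rewrite /Y le_max lexx orbT.
exists (fine 'V_P[SY]); have VF := variance_fin_num S2.
  by rewrite -/(fun t => \sum_(w in B) Y w t) SE fineK.
by rewrite -!lee_fin -lte_fin fineK// Vgt Vle.
Qed.

End clamped_noise.

(** * Sets in the sigma-algebra generated by a partition *)

(** Such a set contains every block it meets, so the block of any of its points will do. *)
Lemma in_sigma_block_subset {D : finType} {Om : {set {set D}}} {A : {set D}} :
  finset.partition Om [set: D] -> A != finset.set0 -> in_sigma Om A ->
  exists2 w, w \in Om & w \subset A.
Proof.
move=> /and3P[/eqP covOm trivOm _] /set0Pn[x xA] sA.
have satA w y z : w \in Om -> y \in w -> z \in w -> y \in A -> z \in A.
  (* The sets containing every block they meet form a sigma-algebra that contains the blocks, hence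
     the generated one. *)
  pose saturated := [set U : set D | forall w, w \in Om ->
    forall y z, y \in w -> z \in w -> U y -> U z].
  suff sat : <<s [set [set x | x \in w] | w in [set w | w \in Om]] >> `<=` saturated.
    by move=> wOm yw zw; exact: (sat _ sA _ wOm _ _ yw zw).
  apply: smallest_sub.
    split.
    - by [].
    - move=> U satU v vOm a c av cv [_ NUa]; split => // Uc.
      by apply: NUa; exact: (satU v vOm c a).
    - move=> F satF v vOm a c av cv [n _ Fna]; exists n => //.
      exact: (satF n v vOm a c).
  (* Two blocks sharing the point [a] are both the block of [a], hence equal. *)
  move=> _ [u uOm <-] v vOm a c av cv /= au.
  rewrite -(def_pblock trivOm uOm au).
  by rewrite (def_pblock trivOm vOm av).
have xcov : x \in finset.cover Om by rewrite covOm finset.in_setT.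
exists (finset.pblock Om x); first exact: finset.pblock_mem.
apply/fintype.subsetP => y yx; apply: (satA (finset.pblock Om x) x y) => //.
- exact: finset.pblock_mem.
- by rewrite finset.mem_pblock.
Qed.

(** * Comparison of the two utilities *)

Theorem theorem4 (R : realType) (D : finType) (N : D -> nat)
  (K : nat) (Om : 'I_K -> {set {set D}})
  (Qn : nat) (A : 'I_Qn -> {set D}) (kq : 'I_Qn -> option 'I_K)
  (p eps : R)
  (d1 : measure_display) (T1 : measurableType d1) (P1 : probability T1 R)
  (xi : 'I_Qn -> {RV P1 >-> R})
  (d2 : measure_display) (T2 : measurableType d2) (P2 : probability T2 R)
  (Z : 'I_Qn + ('I_K * {set D}) -> {RV P2 >-> R}) :
  (forall k, finset.partition (Om k) [set: D]) ->
  (forall i, A i != finset.set0) ->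
  (forall i, kq i = None -> forall k, ~ in_sigma (Om k) (A i)) ->
  (forall i k, kq i = Some k -> in_sigma (Om k) (A i)) ->
  0 <= p < 1 ->
  (#|[pred i | kq i == None]|)%:R = p * Qn%:R ->
  0 < eps ->
  let S := \sum_(k < K) #|Om k| in
  let M := \max_(k < K) #|Om k| in
  let eps' := (1 - p) * Qn%:R * eps / S%:R in
  (* benchmark noises: i.i.d. Lap(1/eps) *)
  (forall i, laplace_law P1 (xi i) eps^-1) ->
  mutually_independent P1 [set: 'I_Qn] xi ->
  (* sigma-counting noises: independent, Lap(1/eps) for queries outside
     every sigma-algebra, Lap(1/eps') for the blocks of the partitions *)
  (forall i, kq i = None -> laplace_law P2 (Z (inl i)) eps^-1) ->
  (forall k w, w \in Om k -> laplace_law P2 (Z (inr (k, w))) eps'^-1) ->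
  mutually_independent P2 (sigma_noise_index Om kq) Z ->
  S%:R * Num.sqrt M%:R / (1 - p) < Qn%:R ->
  utility P2 Qn (sigma_answer P2 N Om A kq Z) > utility P1 Qn (bench_answer P1 N A xi).
Proof.
move=> partOm A0 kqN kqS /andP[p0 p1] cardN eps0 S M eps' lapxi _ lapN lapS indZ hQ.
(* This covers both the benchmark answers and the queries outside every sigma-algebra. *)
have eq_var (d : measure_display) (T : measurableType d) (P : probability T R)
    (X : {RV P >-> R}) (c : R) : laplace_law P X eps^-1 ->
    fine 'V_P[fun t => c + X t] = 2 * eps^-1 ^+ 2.
  move=> lapX; have e0 : 0 < eps^-1 by rewrite invr_gt0.
  rewrite -/(cst c \+ X) varianceD_cst_l; last exact: laplace_law_Lfun2 lapX.
  by rewrite (laplace_law_variance e0 lapX).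
have q0 : 0 < 1 - p by rewrite subr_gt0.
have Qn0 : 0 < Qn%:R :> R.
  by apply: le_lt_trans hQ; rewrite divr_ge0 ?mulr_ge0 ?sqrtr_ge0// ltW.
have sigma_lt i k : kq i = Some k ->
    2 / fine 'V_P1[bench_answer P1 N A xi i] <
    2 / fine 'V_P2[sigma_answer P2 N Om A kq Z i].
  move=> kqi; rewrite eq_var//.
  have [w0 w0Om w0A] := in_sigma_block_subset (partOm k) (A0 i) (kqS i k kqi).
  have Om_gt0 : (0 < #|Om k|)%N by apply/card_gt0P; exists w0.
  have S0 : 0 < S%:R :> R.
    by rewrite ltr0n (leq_trans Om_gt0)// /S (bigD1 k)//= leq_addr.
  have leM : (#|Om k| <= M)%N by exact: (leq_bigmax k).
  (* [r] is the ratio [eps' / eps]; the lower bound on the number of queries says exactly that it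
     exceeds [Num.sqrt M%:R]. *)
  set r := (1 - p) * Qn%:R / S%:R.
  have r0 : 0 < r by rewrite divr_gt0// mulr_gt0.
  have eps'E : eps' = r * eps by rewrite /eps' /r; field; rewrite gt_eqF.
  have eps'0 : 0 < eps' by rewrite eps'E mulr_gt0.
  have Mr : M%:R < r ^+ 2.
    rewrite -(@sqr_sqrtr R M%:R)// ltr_pXn2r ?nnegrE ?sqrtr_ge0// ?(ltW r0)//.
    by rewrite /r ltr_pdivlMr// mulrC [ltRHS]mulrC -ltr_pdivrMr.
  pose B := [set w in Om k | w \subset A i]%SET.
  have BOm w : w \in B -> w \in Om k by rewrite inE => /andP[].
  have [] := @sum_clamp_variance R _ _ P2 _ B (fun w => Z (inr (k, w)))
      (fun w => (Defs.count N w)%:R) eps'^-1.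
  - by rewrite invr_gt0.
  - by apply/set0Pn; exists w0; rewrite inE w0Om.
  - by move=> w.
  - by move=> w /BOm; exact: lapS.
  - move=> v w /BOm vOm /BOm wOm vw A1 A2 mA1 mA2.
    apply: (mutually_independent_pair indZ) => //.
    + by rewrite inE.
    + by rewrite inE.
    + by apply: contra_neq vw => -[].
  move=> v VE /andP[v0 vle].
  have -> : sigma_answer P2 N Om A kq Z i =
      fun t => \sum_(w in B) Num.max ((Defs.count N w)%:R + Z (inr (k, w)) t) 0.
    apply/funext => t; rewrite /sigma_answer kqi.
    by apply: eq_bigl => w; rewrite inE.
  (* Both variances being positive, inverses compare in reverse. It remains that [v <= #|B|%:R * (2
     * eps'^-1 ^+ 2) < 2 * eps^-1 ^+ 2], which follows from [#|B| <= M] and [M%:R < r ^+ 2]. *)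
  rewrite VE /= ltr_pM2l// ltf_pV2 ?posrE ?mulr_gt0 ?exprn_gt0 ?invr_gt0//.
  apply: (le_lt_trans vle); rewrite mulrCA ltr_pM2l//.
  rewrite eps'E invfM exprMn mulrA gtr_pMl ?exprn_gt0 ?invr_gt0//.
  rewrite exprVn ltr_pdivrMr ?exprn_gt0// mul1r; apply: le_lt_trans Mr.
  rewrite ler_nat (leq_trans _ leM)//; apply: subset_leq_card.
  by apply/fintype.subsetP => w /BOm.
have sigma_le i : 2 / fine 'V_P1[bench_answer P1 N A xi i] <=
    2 / fine 'V_P2[sigma_answer P2 N Om A kq Z i].
  case kqi : (kq i) => [k|]; first exact/ltW/(sigma_lt _ _ kqi).
  by rewrite /sigma_answer kqi !eq_var//; exact: lapN.
(* Strictness needs one query answered through a partition. Otherwise all queries would be counted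
   by [p * Qn%:R], impossible for [p < 1] and [Qn] positive. *)
have [i0 [k kqi0]] : exists i k, kq i = Some k.
  apply: contrapT => noS.
  have : #|[pred i | kq i == None]| = Qn.
    rewrite -[RHS]card_ord; apply: eq_card => i; rewrite !inE.
    by case kqi : (kq i) => [k|]//; exfalso; apply: noS; exists i, k.
  by move=> cQ; move: cardN; rewrite cQ => Qp; nra.
rewrite /utility ltr_pM2l ?invr_gt0//.
rewrite (bigD1 i0)//= [ltRHS](bigD1 i0)//= ltr_leD//; first exact: sigma_lt kqi0.
by apply: ler_sum => i _.
Qed.
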